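(* Consider problem (P) whose linear constraints $a_j^Tx\le b_j$, $j=1,\dots,m$, include the nonnegativity constraints $x\ge0$. Let $u\in\mathbb{R}^n$ have all entries positive, let $\Omega$ be a set containing the feasible region of (P), and suppose $\alpha_u=\max\{u^Tx: x\in\Omega\}>0$ is attained. Let $(\mathrm{SDP_{GSRT}})$ denote the relaxation of (P) defined in the context (of type A, or of type B when $c_i\in\mathrm{Range}(Q_i)$ for all $i\in\mathcal{N}$), and let $(\mathrm{SDP_{\alpha GSRT}})$ denote the relaxation of the same type obtained by applying the RLT, SOC-RLT and GSRT constraints to problem (P) with the additional redundant linear constraint $u^Tx\le\alpha_u$ (that is, the same construction with the $m+1$ linear constraints $a_j^Tx\le b_j$, $j=1,\dots,m+1$, where $a_{m+1}=u$, $b_{m+1}=\alpha_u$). Then $$v(\mathrm{SDP_{\alpha GSRT}})\ \ge\ v(\mathrm{SDP_{GSRT}}),$$ where $v(\cdot)$ denotes the optimal value (infimum, $+\infty$ if infeasible).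
   Context: Data: $Q_0,\dots,Q_l$ real symmetric $n\times n$ matrices ($Q_i\ne 0$ for $i\ge 1$), $c_0,\dots,c_l\in\mathbb{R}^n$, $d_1,\dots,d_l\in\mathbb{R}$, $a_1,\dots,a_m\in\mathbb{R}^n$, $b_1,\dots,b_m\in\mathbb{R}$. Problem (P): minimize $x^TQ_0x+c_0^Tx$ over $x\in\mathbb{R}^n$ subject to $x^TQ_ix+c_i^Tx+d_i\le 0$ ($i=1,\dots,l$) and $a_j^Tx\le b_j$ ($j=1,\dots,m$). Let $\mathcal{C}=\{i: Q_i\succeq 0\}$ and $\mathcal{N}=\{1,\dots,l\}\setminus\mathcal{C}$. For $i\in\mathcal{C}$ fix $B_i\in\mathbb{R}^{n\times n}$ with $Q_i=B_i^TB_i$. For $i\in\mathcal{N}$ write $Q_i=L_i^TL_i-M_i^TM_i$, where, from a spectral decomposition of $Q_i$, the rows of $L_i$ are $\sqrt{\lambda}\,v^T$ over the positive eigenvalues $\lambda$ (orthonormal eigenvectors $v$) and the rows of $M_i$ are $\sqrt{-\lambda}\,v^T$ over the negative eigenvalues. $A\cdot B=\sum_{i,j}A_{ij}B_{ij}$, $\|\cdot\|$ is the Euclidean norm, $Q^{\dagger}$ the Moore-Penrose pseudoinverse. The relaxation $(\mathrm{SDP_{GSRT}})$ has variables $x\in\mathbb{R}^n$, symmetric $X\in\mathbb{R}^{n\times n}$, $z\in\mathbb{R}^{\mathcal{N}}$, $S\in\mathbb{R}^{n\times\mathcal{N}}$ (columns $S_{\cdot,i}$), symmetric $Z\in\mathbb{R}^{\mathcal{N}\times\mathcal{N}}$,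 and minimizes $Q_0\cdot X+c_0^Tx$ subject to: (1) $Q_i\cdot X+c_i^Tx+d_i\le0$, $i=1,\dots,l$; (2) $a_j^Tx\le b_j$, $j=1,\dots,m$; (3) $\begin{pmatrix}1&x^T&z^T\\ x&X&S\\ z&S^T&Z\end{pmatrix}\succeq0$; (4) (RLT) $a_ia_j^T\cdot X+b_ib_j-b_ja_i^Tx-b_ia_j^Tx\ge0$ for all $1\le i<j\le m$; (5) (SOC-RLT) for all $i\in\mathcal{C}$, $j=1,\dots,m$: $\left\|\begin{pmatrix}B_i(b_jx-Xa_j)\\ \tfrac12\left(-c_i^TXa_j+(b_jc_i^T-d_ia_j^T-a_j^T)x+(1+d_i)b_j\right)\end{pmatrix}\right\|\le\tfrac12\left(c_i^TXa_j+(d_ia_j^T-a_j^T-b_jc_i^T)x+(1-d_i)b_j\right)$; (6) (GSRT) for each $i\in\mathcal{N}$ and all $j=1,\dots,m$, the type A or the type B constraints below. Type A: $\left\|\begin{pmatrix}L_ix\\ \frac12(c_i^Tx+d_i+1)\end{pmatrix}\right\|\le z_i$, $\left\|\begin{pmatrix}M_ix\\ \frac12(c_i^Tx+d_i-1)\end{pmatrix}\right\|\le z_i$, $\left\|\begin{pmatrix}L_i(b_jx-Xa_j)\\ \frac12(c_i^T(b_jx-Xa_j)+(d_i+1)(b_j-a_j^Tx))\end{pmatrix}\right\|\le z_ib_j-S_{\cdot,i}^Ta_j$, $\left\|\begin{pmatrix}M_i(b_jx-Xa_j)\\ \frac12(c_i^T(b_jx-Xa_j)+(d_i-1)(b_j-a_j^Tx))\end{pmatrix}\right\|\le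 z_ib_j-S_{\cdot,i}^Ta_j$, $Z_{i,i}=X\cdot M_i^TM_i+\frac14\left(c_ic_i^T\cdot X+(d_i-1)^2+2(d_i-1)c_i^Tx\right)$. Type B (when $c_i\in\mathrm{Range}(Q_i)$ for all $i\in\mathcal{N}$): let $p_i=\frac12Q_i^{\dagger}c_i$, $\delta_i=\frac14c_i^TQ_i^{\dagger}c_i-d_i$, $w_{ij}=b_jx-Xa_j+p_i(b_j-a_j^Tx)$, $\pi_i=M_i^TM_i\cdot(X+\frac14Q_i^{\dagger}c_ic_i^TQ_i^{\dagger}+Q_i^{\dagger}c_ix^T)$. If $\delta_i>0$: $\|L_i(x+p_i)\|\le z_i$, $\left\|\begin{pmatrix}M_i(x+p_i)\\ \sqrt{\delta_i}\end{pmatrix}\right\|\le z_i$, $Z_{i,i}=\pi_i+\delta_i$, $\|L_iw_{ij}\|\le z_ib_j-a_j^TS_{\cdot,i}$, $\left\|\begin{pmatrix}M_iw_{ij}\\ \sqrt{\delta_i}(b_j-a_j^Tx)\end{pmatrix}\right\|\le z_ib_j-a_j^TS_{\cdot,i}$. If $\delta_i\le0$: $\left\|\begin{pmatrix}L_i(x+p_i)\\ \sqrt{-\delta_i}\end{pmatrix}\right\|\le z_i$, $\|M_i(x+p_i)\|\le z_i$, $Z_{i,i}=\pi_i$, $\left\|\begin{pmatrix}L_iw_{ij}\\ \sqrt{-\delta_i}(b_j-a_j^Tx)\end{pmatrix}\right\|\le z_ib_j-a_j^TS_{\cdot,i}$, $\|M_iw_{ij}\|\le z_ib_j-a_j^TS_{\cdot,i}$.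 *)

(* Defs.v *)
From HB Require Import structures.
From mathcomp Require Import all_boot all_order all_algebra.
From mathcomp Require Import all_classical all_reals.
From mathcomp Require Import ereal.

Set Implicit Arguments.
Unset Strict Implicit.
Unset Printing Implicit Defensive.

Import Order.TTheory GRing.Theory Num.Theory.

Local Open Scope classical_set_scope.
Local Open Scope ring_scope.

Section LinearAlgebra.
Variable R : realType.

Definition dotv n (u v : 'cV[R]_n) : R := (u^T *m v) 0 0.

Definition mxdot m n (A B : 'M[R]_(m, n)) : R :=
  \sum_(i < m) \sum_(j < n) A i j * B i j.

(* The library norm `|v| of a matrix is the sup norm, hence this definition. *)
Definition enorm n (v : 'cV[R]_n) : R := Num.sqrt (\sum_(i < n) v i 0 ^+ 2).

(* The column obtained by putting the scalar s below v. *)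
Definition stack n (v : 'cV[R]_n) (s : R) : 'cV[R]_(n + 1) := col_mx v s%:M.

Definition psd n (A : 'M[R]_n) : Prop :=
  A^T = A /\ forall x : 'cV[R]_n, 0 <= dotv x (A *m x).

Definition is_pinv m n (A : 'M[R]_(m, n)) (X : 'M[R]_(n, m)) : Prop :=
  [/\ A *m X *m A = A, X *m A *m X = X,
      (A *m X)^T = A *m X & (X *m A)^T = X *m A].

(* Moore-Penrose pseudoinverse: the default value 0 is never used,
   by pinvP and is_pinv_uniq below. *)
Definition pinv m n (A : 'M[R]_(m, n)) : 'M[R]_(n, m) :=
  xget 0 [set X | is_pinv A X].

Lemma is_pinv_uniq m n (A : 'M[R]_(m, n)) X Y :
  is_pinv A X -> is_pinv A Y -> X = Y.
Proof.
move=> [AXA XAX sAX sXA] [AYA YAY sAY sYA].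
have eAXY : A *m X = A *m Y.
  by rewrite -sAX -{1}AYA -[A *m Y *m A *m X]mulmxA trmx_mul sAX sAY mulmxA AXA.
have eXYA : X *m A = Y *m A.
  have -> : X *m A = (X *m A) *m (Y *m A) by rewrite mulmxA -(mulmxA X) -mulmxA AYA.
  rewrite -sXA -sYA -trmx_mul; congr (_^T).
  by rewrite mulmxA -(mulmxA Y) -mulmxA AXA.
by rewrite -XAX -mulmxA eAXY mulmxA eXYA YAY.
Qed.

Lemma gram_unit r n (F : 'M[R]_(r, n)) : row_free F -> F *m F^T \in unitmx.
Proof.
move=> freeF; rewrite -row_free_unit -kermx_eq0; apply/rowV0P => v.
move=> /sub_kermxP vFF0.
apply/eqP; rewrite -(inj_eq (row_free_inj freeF)) mul0mx; apply/eqP.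
have : (v *m F) *m (v *m F)^T = 0 by rewrite trmx_mul mulmxA -(mulmxA v) vFF0 mul0mx.
set w := v *m F => /matrixP/(_ 0 0); rewrite !mxE => /eqP.
rewrite psumr_eq0 => [/allP w0|i _]; last by rewrite [w^T _ _]mxE -expr2 sqr_ge0.
apply/rowP => j; rewrite [RHS]mxE.
by have := w0 j (mem_index_enum _); rewrite /= [w^T _ _]mxE -expr2 sqrf_eq0 => /eqP.
Qed.

Lemma is_pinv_mul m r n (C : 'M[R]_(m, r)) (F : 'M[R]_(r, n)) :
  row_full C -> row_free F ->
  is_pinv (C *m F) (F^T *m invmx (F *m F^T) *m (invmx (C^T *m C) *m C^T)).
Proof.
move=> fullC freeF.
have uF : F *m F^T \in unitmx by apply: gram_unit.
have uC : C^T *m C \in unitmx.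
  by rewrite -{2}[C]trmxK; apply: gram_unit; rewrite /row_free mxrank_tr.
set G := F^T *m invmx (F *m F^T); set H := invmx (C^T *m C) *m C^T.
have FG : F *m G = 1%:M by rewrite /G mulmxA mulmxV.
have HC : H *m C = 1%:M by rewrite /H -mulmxA mulVmx.
have AX : C *m F *m (G *m H) = C *m H by rewrite -mulmxA (mulmxA F) FG mul1mx.
have XA : G *m H *m (C *m F) = G *m F by rewrite -mulmxA (mulmxA H) HC mul1mx.
split.
- by rewrite AX -mulmxA (mulmxA H) HC mul1mx.
- by rewrite XA -mulmxA (mulmxA F) FG mul1mx.
- by rewrite AX /H !trmx_mul trmx_inv trmx_mul !trmxK mulmxA.
- by rewrite XA /G !trmx_mul trmx_inv trmx_mul !trmxK mulmxA.
Qed.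

Lemma pinvP m n (A : 'M[R]_(m, n)) : is_pinv A (pinv A).
Proof.
apply: (@xgetPex _ 0 [set X | is_pinv A X]).
have := is_pinv_mul (col_base_full A) (row_base_free A).
by rewrite mulmx_base => hX; eexists; exact: hX.
Qed.

(* Q = \sum_k lam_k v_k v_k^T where the v_k, transposed, are the rows of V and
   form an orthonormal basis. *)
Definition is_spectral_dec n (Q V : 'M[R]_n) (lam : 'rV[R]_n) : Prop :=
  V *m V^T = 1%:M /\ Q = V^T *m diag_mx lam *m V.

Definition pos_idx n (lam : 'rV[R]_n) : {set 'I_n} := finset (fun k => 0 < lam 0 k).

Definition neg_idx n (lam : 'rV[R]_n) : {set 'I_n} := finset (fun k => lam 0 k < 0).

Definition Lfactor n (V : 'M[R]_n) (lam : 'rV[R]_n) : 'M[R]_(#|pos_idx lam|, n) :=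
  \matrix_(r, c) (Num.sqrt (lam 0 (enum_val r)) * V (enum_val r) c).

Definition Mfactor n (V : 'M[R]_n) (lam : 'rV[R]_n) : 'M[R]_(#|neg_idx lam|, n) :=
  \matrix_(r, c) (Num.sqrt (- lam 0 (enum_val r)) * V (enum_val r) c).

End LinearAlgebra.

(* The quadratic constraints are indexed by 'I_l and the linear ones by 'I_m. *)
Record qcqp (R : realType) (n l m : nat) := Qcqp {
  Q0 : 'M[R]_n;
  c0 : 'cV[R]_n;
  Qm : 'I_l -> 'M[R]_n;
  cv : 'I_l -> 'cV[R]_n;
  dc : 'I_l -> R;
  av : 'I_m -> 'cV[R]_n;
  bc : 'I_m -> R }.

(* Bm i is used for i in Cset only; Vm i and lamv i for i in Nset only. *)
Record factors (R : realType) (n l : nat) := Factors {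
  Bm : 'I_l -> 'M[R]_n;
  Vm : 'I_l -> 'M[R]_n;
  lamv : 'I_l -> 'rV[R]_n }.

Inductive gsrt_type := TypeA | TypeB.

Section Problem.
Variables (R : realType) (n l m : nat).
Implicit Types (P : qcqp R n l m).

Definition wf_qcqp P : Prop :=
  [/\ (Q0 P)^T = Q0 P, forall i, (Qm P i)^T = Qm P i & forall i, Qm P i != 0].

Definition qcqp_feasible P (x : 'cV[R]_n) : Prop :=
  (forall i, dotv x (Qm P i *m x) + dotv (cv P i) x + dc P i <= 0) /\
  (forall j, dotv (av P j) x <= bc P j).

Definition Cset P : {set 'I_l} := finset (fun i => `[< psd (Qm P i) >]).

Definition Nset P : {set 'I_l} := (~: Cset P)%SET.

Definition wf_factors P (F : factors R n l) : Prop :=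
  (forall i, i \in Cset P -> Qm P i = (Bm F i)^T *m Bm F i) /\
  (forall i, i \in Nset P -> is_spectral_dec (Qm P i) (Vm F i) (lamv F i)).

Definition N_in_range P : Prop :=
  forall i, i \in Nset P -> exists y : 'cV[R]_n, cv P i = Qm P i *m y.

Definition includes_nonneg P : Prop :=
  forall k : 'I_n, exists j : 'I_m, av P j = - delta_mx k 0 /\ bc P j = 0.

Definition add_lin P (u : 'cV[R]_n) (alpha : R) : qcqp R n l (m + 1) :=
  {| Q0 := Q0 P; c0 := c0 P; Qm := Qm P; cv := cv P; dc := dc P;
     av := fun j => match fintype.split j with inl j' => av P j' | inr _ => u end;
     bc := fun j => match fintype.split j with inl j' => bc P j' | inr _ => alpha end |}.

End Problem.

(* N is the cardinality of Nset; its k-th element is enum_val k. *)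
Record sdp_var (R : realType) (n N : nat) := SdpVar {
  vx : 'cV[R]_n;
  vX : 'M[R]_n;
  vz : 'cV[R]_N;
  vS : 'M[R]_(n, N);
  vZ : 'M[R]_N }.

Section Relaxation.
Variables (R : realType) (n l m : nat).
Variables (P : qcqp R n l m) (F : factors R n l).

Definition moment_mx N (y : sdp_var R n N) : 'M[R]_(1 + (n + N)) :=
  block_mx 1%:M (row_mx (vx y)^T (vz y)^T)
           (col_mx (vx y) (vz y)) (block_mx (vX y) (vS y) (vS y)^T (vZ y)).

Definition rlt N (y : sdp_var R n N) (i j : 'I_m) : Prop :=
  let: (x, X) := (vx y, vX y) in
  0 <= mxdot (av P i *m (av P j)^T) X + bc P i * bc P j
       - bc P j * dotv (av P i) x - bc P i * dotv (av P j) x.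

Definition soc_rlt N (y : sdp_var R n N) (i : 'I_l) (j : 'I_m) : Prop :=
  let: (x, X) := (vx y, vX y) in
  let: (c, d) := (cv P i, dc P i) in
  let: (a, b) := (av P j, bc P j) in
  enorm (stack (Bm F i *m (b *: x - X *m a))
               (2^-1 * (- dotv c (X *m a) + dotv (b *: c - d *: a - a) x
                        + (1 + d) * b)))
  <= 2^-1 * (dotv c (X *m a) + dotv (d *: a - a - b *: c) x + (1 - d) * b).

Definition gsrtA (y : sdp_var R n #|Nset P|) (k : 'I_#|Nset P|) : Prop :=
  let: (x, X, zi, Si) := (vx y, vX y, vz y k 0, col k (vS y)) in
  let i : 'I_l := enum_val k in
  let: (c, d) := (cv P i, dc P i) in
  let L := Lfactor (Vm F i) (lamv F i) in
  let M := Mfactor (Vm F i) (lamv F i) in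
  [/\ enorm (stack (L *m x) (2^-1 * (dotv c x + d + 1))) <= zi,
      enorm (stack (M *m x) (2^-1 * (dotv c x + d - 1))) <= zi,
      vZ y k k = mxdot X (M^T *m M)
        + 4^-1 * (mxdot (c *m c^T) X + (d - 1) ^+ 2 + 2 * (d - 1) * dotv c x)
    & forall j : 'I_m,
        let: (a, b) := (av P j, bc P j) in
        let w := b *: x - X *m a in
        enorm (stack (L *m w) (2^-1 * (dotv c w + (d + 1) * (b - dotv a x))))
          <= zi * b - dotv Si a /\
        enorm (stack (M *m w) (2^-1 * (dotv c w + (d - 1) * (b - dotv a x))))
          <= zi * b - dotv Si a].

Definition gsrtB (y : sdp_var R n #|Nset P|) (k : 'I_#|Nset P|) : Prop :=
  let: (x, X, zi, Si) := (vx y, vX y, vz y k 0, col k (vS y)) in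
  let i : 'I_l := enum_val k in
  let: (c, d) := (cv P i, dc P i) in
  let L := Lfactor (Vm F i) (lamv F i) in
  let M := Mfactor (Vm F i) (lamv F i) in
  let Qd := pinv (Qm P i) in
  let p := 2^-1 *: (Qd *m c) in
  let delta := 4^-1 * dotv c (Qd *m c) - d in
  let w j := bc P j *: x - X *m av P j + (bc P j - dotv (av P j) x) *: p in
  let pii := mxdot (M^T *m M)
               (X + 4^-1 *: (Qd *m c *m c^T *m Qd) + Qd *m c *m x^T) in
  (0 < delta ->
    [/\ enorm (L *m (x + p)) <= zi,
        enorm (stack (M *m (x + p)) (Num.sqrt delta)) <= zi,
        vZ y k k = pii + delta
      & forall j : 'I_m,
          let: (a, b) := (av P j, bc P j) in
          enorm (L *m w j) <= zi * b - dotv a Si /\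
          enorm (stack (M *m w j) (Num.sqrt delta * (b - dotv a x)))
            <= zi * b - dotv a Si]) /\
  (delta <= 0 ->
    [/\ enorm (stack (L *m (x + p)) (Num.sqrt (- delta))) <= zi,
        enorm (M *m (x + p)) <= zi,
        vZ y k k = pii
      & forall j : 'I_m,
          let: (a, b) := (av P j, bc P j) in
          enorm (stack (L *m w j) (Num.sqrt (- delta) * (b - dotv a x)))
            <= zi * b - dotv a Si /\
          enorm (M *m w j) <= zi * b - dotv a Si]).

Definition gsrt (ty : gsrt_type) :=
  match ty with TypeA => gsrtA | TypeB => gsrtB end.

Record sdp_gsrt_feasible (ty : gsrt_type) (y : sdp_var R n #|Nset P|) : Prop := {
  feas_symX : (vX y)^T = vX y;
  feas_symZ : (vZ y)^T = vZ y;
  feas_quad : forall i, mxdot (Qm P i) (vX y) + dotv (cv P i) (vx y) + dc P i <= 0;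
  feas_lin : forall j, dotv (av P j) (vx y) <= bc P j;
  feas_psd : psd (moment_mx y);
  feas_rlt : forall i j : 'I_m, (i < j)%N -> rlt y i j;
  feas_socrlt : forall i, i \in Cset P -> forall j, soc_rlt y i j;
  feas_gsrt : forall k, gsrt ty y k }.

Definition sdp_obj N (y : sdp_var R n N) : R :=
  mxdot (Q0 P) (vX y) + dotv (c0 P) (vx y).

Definition v_sdp_gsrt (ty : gsrt_type) : \bar R :=
  ereal_inf [set (sdp_obj y)%:E | y in [set y | sdp_gsrt_feasible ty y]].

End Relaxation.

(* Main.v *)
Require Import Defs.
From mathcomp Require Import all_boot all_order all_algebra.
From mathcomp Require Import all_classical all_reals ereal.

Import Order.TTheory GRing.Theory Num.Theory.

Local Open Scope classical_set_scope.
Local Open Scope ring_scope.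

(** The added inequality [dotv u x <= alpha] changes neither the quadratic data
    nor the objective, so both relaxations have the same index set [Nset P],
    hence the same variables, and minimize the same function.  Every constraint
    of the relaxation depends on the linear inequalities only through single
    indices [j], or through pairs [i < j] for RLT.  The old inequalities keep
    their data and their order as the first [m] of the [m + 1], so each
    constraint of the relaxation of [P] occurs among those of the relaxation of
    [add_lin P u alpha].  The latter thus has the smaller feasible set
    ([add_lin_feasible]), and an infimum over a smaller set is larger. *)

Section AddLin.
Variables (R : realType) (n l m : nat) (P : qcqp R n l m) (F : factors R n l).
Variables (u : 'cV[R]_n) (alpha : R).

Lemma av_add_lin j : av (add_lin P u alpha) (lshift 1 j) = av P j.
Proof. by rewrite /= (unsplitK (inl j)). Qed.

Lemma bc_add_lin j : bc (add_lin P u alpha) (lshift 1 j) = bc P j.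
Proof. by rewrite /= (unsplitK (inl j)). Qed.

Lemma add_lin_gsrtA y k :
  gsrtA (P := add_lin P u alpha) F y k -> gsrtA (P := P) F y k.
Proof.
case=> hL hM hZ hlin; split=> // j.
by have := hlin (lshift 1 j); rewrite av_add_lin bc_add_lin.
Qed.

Lemma add_lin_gsrtB y k :
  gsrtB (P := add_lin P u alpha) F y k -> gsrtB (P := P) F y k.
Proof.
case=> hpos hneg; split.
  move=> /hpos [hL hM hZ hlin]; split=> // j.
  by have := hlin (lshift 1 j); rewrite av_add_lin bc_add_lin.
move=> /hneg [hL hM hZ hlin]; split=> // j.
by have := hlin (lshift 1 j); rewrite av_add_lin bc_add_lin.
Qed.

(** Typing [y] in both relaxations relies on [Nset (add_lin P u alpha)] being
    convertible to [Nset P]. *)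
Lemma add_lin_feasible ty y :
  sdp_gsrt_feasible (P := add_lin P u alpha) F ty y ->
  sdp_gsrt_feasible (P := P) F ty y.
Proof.
case=> symX symZ quad lin hpsd hrlt hsoc hgsrt; split=> //.
- by move=> j; have := lin (lshift 1 j); rewrite av_add_lin bc_add_lin.
- move=> i j ltij.
  by have := hrlt (lshift 1 i) (lshift 1 j) ltij; rewrite /rlt !av_add_lin !bc_add_lin.
- move=> i iC j.
  by have := hsoc i iC (lshift 1 j); rewrite /soc_rlt av_add_lin bc_add_lin.
- case: ty hgsrt => hgsrt k; first exact: add_lin_gsrtA (hgsrt k).
  exact: add_lin_gsrtB (hgsrt k).
Qed.

End AddLin.

Theorem theorem3p5 (R : realType) (n l m : nat) (P : qcqp R n l m)
    (F : factors R n l) (ty : gsrt_type)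
    (u : 'cV[R]_n) (Omega : set 'cV[R]_n) (alpha : R)
    (hP : wf_qcqp P) (hF : wf_factors P F)
    (hty : ty = TypeB -> N_in_range P)
    (hnonneg : includes_nonneg P)
    (hu : forall k, 0 < u k 0)
    (hOmega : [set x | qcqp_feasible P x] `<=` Omega)
    (halpha_attained : exists2 x, Omega x & dotv u x = alpha)
    (halpha_max : forall x, Omega x -> dotv u x <= alpha)
    (halpha_gt0 : 0 < alpha) :
  (v_sdp_gsrt (add_lin P u alpha) F ty >= v_sdp_gsrt P F ty)%E.
Proof.
apply: ereal_inf_le_tmp => _ [y hy <-].
by exists y => //; apply: add_lin_feasible hy.
Qed.
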